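(* Let $c>-1$, $d\ge0$, $\beta>1$ be real constants and let $z_n=(n+c)^\beta+d$ for all integers $n\ge1$. Let $\alpha\ge0$. Define $\zeta_{\mathbf z}(s):=\sum_{n=1}^\infty z_n^{-s}$ for $\mathrm{Re}(s)>1$, $(n;k)_{\mathbf z,\alpha}:=z_n^\alpha\prod_{i=1}^k(z_n-z_i)$ for integers $n\ge1,k\ge0$, and for $k\ge1$ \[ \gamma_k(x):=\frac{1}{z_k-x}\cdot\frac{1}{(k;k-1)_{\mathbf z,\alpha}}+\sum_{n=k+1}^\infty\frac{1}{(n;k)_{\mathbf z,\alpha}}. \] Then for all complex $x$ with $|x|<\min\{1,z_1\}$, \[ \sum_{m=0}^\infty\zeta_{\mathbf z}(m+\alpha+1)x^m=\sum_{k=1}^\infty\gamma_k(x)\prod_{\ell=1}^{k-1}(x-z_\ell). \]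
   Context: Empty products equal $1$. *)

(* Defs.v *)
From Stdlib Require Import Reals.
From Coquelicot Require Import Coquelicot.

Open Scope R_scope.

(** Sequences [z : nat -> R] are indexed from [1]; the value [z 0] is never
    used.  [Iter.iter_nat op e f 1 k] is [f 1 op ... op f k], and is [e] for
    [k = 0], which is the empty-product convention. *)

Definition zseq (c d beta : R) (n : nat) : R := Rpower (INR n + c) beta + d.

Definition Rprod1 (f : nat -> R) (k : nat) : R := Iter.iter_nat Rmult 1 f 1 k.

Definition Cprod1 (f : nat -> C) (k : nat) : C := Iter.iter_nat Cmult (RtoC 1) f 1 k.

(** [t ^ s = exp (s * ln t)] for a real base [t > 0] and a complex exponent. *)
Definition Rcpow (t : R) (s : C) : C :=
  (RtoC (exp (Re s * ln t)) * (cos (Im s * ln t), sin (Im s * ln t)))%C.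

(** The sum of a convergent complex series, in the style of Coquelicot's
    [Series]: total, and meaningful only when [ex_series a] holds. *)
Definition CSeries (a : nat -> C) : C :=
  (Series (fun n => Re (a n)), Series (fun n => Im (a n))).

Definition zeta_term (z : nat -> R) (s : C) (n : nat) : C :=
  Rcpow (z n) (Copp s).

Definition zeta (z : nat -> R) (s : C) : C :=
  CSeries (fun j => zeta_term z s (S j)).

(** The symbol [(n;k)_{z,alpha}]. *)
Definition bracket (z : nat -> R) (alpha : R) (n k : nat) : R :=
  Rpower (z n) alpha * Rprod1 (fun i => z n - z i) k.

(** The [j]-th term of the tail sum over [n >= k+1] is the one at
    [n = k + 1 + j]. *)
Definition tail_term (z : nat -> R) (alpha : R) (k j : nat) : R :=
  1 / bracket z alpha (k + 1 + j) k.

Definition gamma (z : nat -> R) (alpha : R) (k : nat) (x : C) : C :=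
  (1 / (RtoC (z k) - x) * (1 / RtoC (bracket z alpha k (k - 1)))
   + RtoC (Series (tail_term z alpha k)))%C.

(* Main.v *)
Require Import Defs.
From Stdlib Require Import Reals Lra Lia.
From Coquelicot Require Import Coquelicot.

Open Scope R_scope.

(** Both sides equal [sum_n z_n^(-alpha) / (z_n - x)], and both series telescope.
    Expanding [1 / (z_n - x)] as a geometric series leaves after [m] terms the
    factor [(x / z_n)^m]; Newton interpolation of [y |-> 1 / (y - x)] at
    [z_1, ..., z_N] leaves, for [n > N], the factor
    [prod_(l <= N) (x - z_l) / (z_n - z_l)], while for [n <= N] it is exact.
    With [u_l = l + c], Bernoulli's inequality gives
    [z_n - z_l >= beta * u_l^(beta-1) * (n - l)], and
    [prod_(l <= N) (n - l) >= N!], so the second factor is at most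
    [prod_(l <= N) (z_l + |x|) / (beta * u_l^(beta-1) * l)]; the factors of this
    product tend to [1 / beta < 1]. *)

(** * Finite products *)

Lemma Rprod1_S (f : nat -> R) (k : nat) : Rprod1 f (S k) = Rprod1 f k * f (S k).
Proof.
  unfold Rprod1.
  rewrite (Iter.iter_nat_Chasles Rmult 1 Rmult_1_l
             (fun a b c => eq_sym (Rmult_assoc a b c)) f 1 k (S k)) by lia.
  now rewrite (Iter.iter_nat_point Rmult 1 Rmult_1_r).
Qed.

Lemma Rprod1_S_front (f : nat -> R) (k : nat) :
  Rprod1 f (S k) = f 1%nat * Rprod1 (fun i => f (S i)) k.
Proof.
  induction k as [|k IH].
  - unfold Rprod1, Iter.iter_nat; simpl; ring.
  - rewrite Rprod1_S, IH, (Rprod1_S (fun i => f (S i))); ring.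
Qed.

Lemma Cprod1_S (f : nat -> C) (k : nat) :
  Cprod1 f (S k) = Cmult (Cprod1 f k) (f (S k)).
Proof.
  unfold Cprod1.
  rewrite (Iter.iter_nat_Chasles Cmult (RtoC 1) Cmult_1_l Cmult_assoc f 1 k (S k)) by lia.
  now rewrite (Iter.iter_nat_point Cmult (RtoC 1) Cmult_1_r).
Qed.

Lemma Rprod1_mult (f g : nat -> R) (k : nat) :
  Rprod1 (fun i => f i * g i) k = Rprod1 f k * Rprod1 g k.
Proof.
  induction k as [|k IH].
  - unfold Rprod1, Iter.iter_nat; simpl; ring.
  - rewrite !Rprod1_S, IH; ring.
Qed.

Lemma Rprod1_pos (f : nat -> R) (k : nat) :
  (forall i, (1 <= i <= k)%nat -> 0 < f i) -> 0 < Rprod1 f k.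
Proof.
  induction k as [|k IH]; intros Hf.
  - unfold Rprod1, Iter.iter_nat; simpl; lra.
  - rewrite Rprod1_S; apply Rmult_lt_0_compat; [apply IH|]; intros; apply Hf; lia.
Qed.

Lemma Rprod1_le (f g : nat -> R) (k : nat) :
  (forall i, (1 <= i <= k)%nat -> 0 < f i <= g i) -> Rprod1 f k <= Rprod1 g k.
Proof.
  induction k as [|k IH]; intros Hf.
  - apply Rle_refl.
  - rewrite !Rprod1_S; apply Rmult_le_compat.
    + left; apply Rprod1_pos; intros; apply Hf; lia.
    + left; apply Hf; lia.
    + apply IH; intros; apply Hf; lia.
    + apply Hf; lia.
Qed.

Lemma Cmod_Cprod1_le (f : nat -> C) (g : nat -> R) (k : nat) :
  (forall i, (1 <= i <= k)%nat -> Cmod (f i) <= g i) ->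
  Cmod (Cprod1 f k) <= Rprod1 g k.
Proof.
  induction k as [|k IH]; intros Hf.
  - unfold Cprod1, Rprod1, Iter.iter_nat; simpl; rewrite Cmod_1; lra.
  - rewrite Rprod1_S, Cprod1_S, Cmod_mult; apply Rmult_le_compat.
    + apply Cmod_ge_0.
    + apply Cmod_ge_0.
    + apply IH; intros; apply Hf; lia.
    + apply Hf; lia.
Qed.

(** The quotient of the two sides is a binomial coefficient, [n - 1] over [N]. The induction matches
    the last factor on the left with the first on the right; the remaining factors on the right form
    the same product for [n - 1]. *)
Lemma Rprod1_INR_le (N n : nat) : (N < n)%nat ->
  Rprod1 INR N <= Rprod1 (fun i => INR n - INR i) N.
Proof.
  revert n; induction N as [|N IH]; intros n Hn.
  - apply Rle_refl.
  - rewrite Rprod1_S, Rprod1_S_front, Rmult_comm.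
    destruct n as [|n]; [lia|].
    assert (Hshift : Rprod1 (fun i => INR (S n) - INR (S i)) N
                     = Rprod1 (fun i => INR n - INR i) N).
    { apply Iter.iter_nat_ext_loc; intros; rewrite !S_INR; ring. }
    rewrite Hshift; apply Rmult_le_compat.
    + apply pos_INR.
    + left; apply Rprod1_pos; intros i Hi; apply lt_0_INR; lia.
    + assert (INR (S N) <= INR n) by (apply le_INR; lia).
      rewrite (S_INR n); change (INR 1) with 1; lra.
    + apply IH; lia.
Qed.

(** * Complex series: absolute convergence and telescoping *)

Lemma sum_n_fst (a : nat -> C) (n : nat) : fst (sum_n a n) = sum_n (fun j => fst (a j)) n.
Proof.
  induction n as [|n IH]; [now rewrite !sum_O|].
  rewrite !sum_Sn, <- IH; reflexivity.
Qed.

Lemma sum_n_snd (a : nat -> C) (n : nat) : snd (sum_n a n) = sum_n (fun j => snd (a j)) n.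
Proof.
  induction n as [|n IH]; [now rewrite !sum_O|].
  rewrite !sum_Sn, <- IH; reflexivity.
Qed.

Lemma CSeries_unique (a : nat -> C) (l : C) : is_series a l -> CSeries a = l.
Proof.
  intros H; destruct l as [l1 l2]; unfold CSeries; f_equal; apply is_series_unique.
  - apply (filterlim_ext (fun n => fst (sum_n a n))).
    + intros n; apply sum_n_fst.
    + eapply filterlim_comp; [exact H|]; apply (continuous_fst l1 l2).
  - apply (filterlim_ext (fun n => snd (sum_n a n))).
    + intros n; apply sum_n_snd.
    + eapply filterlim_comp; [exact H|]; apply (continuous_snd l1 l2).
Qed.

(** Domination gives some limit, by completeness of the complex numbers; taking components
    identifies it with [CSeries a]. *)
Lemma CSeries_correct (a : nat -> C) (b : nat -> R) :
  (forall n, Cmod (a n) <= b n) -> ex_series b -> is_series a (CSeries a).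
Proof.
  intros Hab Hb.
  destruct (@ex_series_le C_AbsRing C_CompleteNormedModule a b Hab Hb) as [l Hl].
  now rewrite (CSeries_unique a l Hl).
Qed.

Lemma CSeries_RtoC (a : nat -> R) : CSeries (fun n => RtoC (a n)) = RtoC (Series a).
Proof.
  unfold CSeries, RtoC; simpl; f_equal.
  apply is_series_unique.
  apply (filterlim_ext (fun _ : nat => 0)); [|apply filterlim_const].
  intros n; symmetry; exact (eq_trans (sum_n_const n 0) (Rmult_0_r _)).
Qed.

Lemma is_series_RtoC (a : nat -> R) :
  (forall n, 0 <= a n) -> ex_series a ->
  is_series (fun n => RtoC (a n)) (RtoC (Series a)).
Proof.
  intros Hpos Ha; rewrite <- CSeries_RtoC.
  apply (CSeries_correct _ a); [|exact Ha].
  intros n; rewrite Cmod_R, Rabs_pos_eq; [apply Rle_refl|apply Hpos].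
Qed.

Lemma Cmod_CSeries_le (a : nat -> C) (b : nat -> R) :
  (forall n, Cmod (a n) <= b n) -> ex_series b -> Cmod (CSeries a) <= Series b.
Proof.
  intros Hab Hb.
  apply (is_lim_seq_le (fun n => Cmod (sum_n a n)) (sum_n b)
           (Cmod (CSeries a)) (Series b)).
  - intros n.
    apply Rle_trans with (sum_n (fun j => Cmod (a j)) n).
    + exact (@norm_sum_n_m C_AbsRing C_NormedModule a 0 n).
    + apply sum_n_m_le; exact Hab.
  - eapply filterlim_comp.
    + exact (CSeries_correct a b Hab Hb).
    + exact (@filterlim_norm C_AbsRing C_NormedModule (CSeries a)).
  - exact (Series_correct b Hb).
Qed.

Lemma is_series_telescope_C (T : nat -> C) (B : nat -> R) :
  (forall N, Cmod (T N) <= B N) -> is_lim_seq B 0 ->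
  is_series (fun N => Cminus (T N) (T (S N))) (T 0%nat).
Proof.
  intros HT HB.
  assert (Hsum : forall n, sum_n (fun N => Cminus (T N) (T (S N))) n
                           = Cminus (T 0%nat) (T (S n))).
  { induction n as [|n IH]; [now rewrite sum_O|].
    rewrite sum_Sn, IH.
    change (Cplus (Cminus (T 0%nat) (T (S n))) (Cminus (T (S n)) (T (S (S n))))
            = Cminus (T 0%nat) (T (S (S n))) :> C); ring. }
  (* Norm balls measure the distance by [Cmod]. The partial sum up to [n] misses the limit by
     exactly [T (S n)], hence the shift of [HB] by one index below. *)
  apply (proj2 (@filterlim_locally_ball_norm C_AbsRing nat C_NormedModule eventually _ _ _)).
  intros eps.
  apply is_lim_seq_incr_1, is_lim_seq_spec in HB.
  destruct (HB eps) as [N0 HN0]; exists N0; intros n Hn.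
  unfold ball_norm; rewrite Hsum.
  change (Cmod (Cminus (Cminus (T 0%nat) (T (S n))) (T 0%nat)) < eps).
  replace (Cminus (Cminus (T 0%nat) (T (S n))) (T 0%nat)) with (Copp (T (S n))) by ring.
  rewrite Cmod_opp.
  specialize (HN0 n Hn); rewrite Rminus_0_r in HN0.
  eapply Rle_lt_trans; [|exact HN0].
  eapply Rle_trans; [apply HT|apply Rle_abs].
Qed.

(** Common engine of both expansions: [r N j] is the remainder left at the [j]-th summand after [N]
    terms. The factored bound makes every remainder series converge absolutely and forces the sums
    to 0 along with [A], so the differences telescope to the sum of [r 0]. This replaces an
    interchange of two infinite sums. The last premise may assume convergence of the two remainder
    series because the bound supplies it. *)
Lemma is_series_remainders
  (r : nat -> nat -> C) (a : nat -> C) (A b : nat -> R) :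
  ex_series b ->
  (forall N j, Cmod (r N j) <= A N * b j) ->
  is_lim_seq A 0 ->
  (forall N, is_series (r N) (CSeries (r N)) -> is_series (r (S N)) (CSeries (r (S N))) ->
             a N = Cminus (CSeries (r N)) (CSeries (r (S N)))) ->
  is_series a (CSeries (r 0%nat)).
Proof.
  intros Hb Hr HA Ha.
  assert (Hex : forall N, ex_series (fun j => A N * b j)).
  { intros N; apply (ex_series_scal (A N) b Hb). }
  apply (is_series_ext (fun N => Cminus (CSeries (r N)) (CSeries (r (S N))))).
  { intros N; symmetry; apply Ha; eapply CSeries_correct;
      [apply Hr|apply Hex|apply Hr|apply Hex]. }
  apply (is_series_telescope_C (fun N => CSeries (r N)) (fun N => A N * Series b)).
  - intros N; rewrite <- Series_scal_l; apply Cmod_CSeries_le; auto.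
  - rewrite <- (Rmult_0_l (Series b)).
    exact (is_lim_seq_scal_r A (Series b) 0 HA).
Qed.

(** * The common summand and its size *)

Definition kernel (z : nat -> R) (alpha : R) (x : C) (n : nat) : C :=
  Cinv (Cmult (RtoC (Rpower (z n) alpha)) (Cminus (RtoC (z n)) x)).

Lemma node_ge_first (z : nat -> R) (n : nat) :
  (forall i j, (1 <= i < j)%nat -> z i < z j) -> (1 <= n)%nat -> z 1%nat <= z n.
Proof.
  intros Hinc Hn; destruct (Nat.eq_dec n 1) as [->|H1]; [lra|].
  left; apply Hinc; lia.
Qed.

Lemma Cmod_minus_ge (t : R) (x : C) : t - Cmod x <= Cmod (Cminus (RtoC t) x).
Proof.
  pose proof (Cmod_triangle (Cminus (RtoC t) x) x) as H.
  replace (Cplus (Cminus (RtoC t) x) x) with (RtoC t) in H by ring.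
  rewrite Cmod_R in H; pose proof (Rle_abs t); lra.
Qed.

Lemma node_minus_neq_0 (t : R) (x : C) : Cmod x < t -> Cminus (RtoC t) x <> 0.
Proof.
  intros H; apply Cmod_gt_0; pose proof (Cmod_minus_ge t x); lra.
Qed.

Lemma Rpower_pos (t a : R) : 0 < Rpower t a.
Proof. apply exp_pos. Qed.

Lemma RtoC_neq_0 (r : R) : 0 < r -> RtoC r <> 0.
Proof. intros H E; apply RtoC_inj in E; lra. Qed.

(** Since [z n >= z 1], one has |x| <= (|x| / z_1) z_n, hence |z_n - x| >= (1 - |x| / z_1) z_n. All
    estimates are thereby reduced to the summability of 1 / z_n, with a constant independent of
    [n]. *)
Lemma Cmod_kernel_le (z : nat -> R) (alpha : R) (x : C) (n : nat) :
  0 <= alpha -> Cmod x < z 1%nat -> z 1%nat <= z n ->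
  Cmod (kernel z alpha x n)
  <= / (Rpower (z 1%nat) alpha * (1 - Cmod x / z 1%nat)) * / z n.
Proof.
  intros Ha Hx Hn.
  pose proof (Cmod_ge_0 x) as Hx0.
  assert (Hq : Cmod x / z 1%nat < 1) by (apply Rlt_div_l; lra).
  unfold kernel.
  assert (Hne : Cminus (RtoC (z n)) x <> 0) by (apply node_minus_neq_0; lra).
  rewrite Cmod_inv by (apply Cmult_neq_0; [apply RtoC_neq_0, Rpower_pos|exact Hne]).
  rewrite Cmod_mult, Cmod_R, Rabs_pos_eq by (left; apply Rpower_pos).
  rewrite <- Rinv_mult.
  apply Rinv_le_contravar.
  - repeat apply Rmult_lt_0_compat; try lra; apply Rpower_pos.
  - rewrite Rmult_assoc; apply Rmult_le_compat.
    + left; apply Rpower_pos.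
    + apply Rmult_le_pos; lra.
    + apply Rle_Rpower_l; lra.
    + eapply Rle_trans; [|apply Cmod_minus_ge].
      assert (Cmod x <= Cmod x / z 1%nat * z n).
      { apply Rle_trans with (Cmod x / z 1%nat * z 1%nat).
        - right; field; lra.
        - apply Rmult_le_compat_l; [apply Rdiv_le_0_compat; lra|lra]. }
      lra.
Qed.

(** * Newton expansion for increasing nodes *)

(** One growing factor of the denominator suffices. With k = N + 1, the factors z_n - z_i for i <= N
    only shrink when z_n is replaced by z_k, which gives the constant [q]. The last one, z_n - z_k,
    is at least (1 - th) z_n, where th = z_k / z_(k+1) < 1. *)
Lemma ex_series_tail_term (z : nat -> R) (alpha : R) (k : nat) :
  0 <= alpha -> 0 < z 1%nat ->
  (forall i j, (1 <= i < j)%nat -> z i < z j) ->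
  ex_series (fun j => / z (S j)) -> (1 <= k)%nat ->
  ex_series (tail_term z alpha k).
Proof.
  intros Ha Hz1 Hinc Hsum Hk.
  destruct k as [|N]; [lia|]; clear Hk.
  assert (Hz : forall n, (1 <= n)%nat -> z 1%nat <= z n).
  { intros n Hn; now apply node_ge_first. }
  set (q := Rprod1 (fun i => z (S N) - z i) N).
  assert (Hq : 0 < q).
  { apply Rprod1_pos; intros i Hi; assert (z i < z (S N)) by (apply Hinc; lia); lra. }
  set (th := z (S N) / z (S (S N))).
  assert (Hth : th < 1).
  { apply Rlt_div_l; [pose proof (Hz (S (S N)) ltac:(lia)); lra|].
    rewrite Rmult_1_l; apply Hinc; lia. }
  apply (ex_series_le (K := R_AbsRing) (V := R_CompleteNormedModule) _
           (fun j => / (Rpower (z 1%nat) alpha * (q * (1 - th))) * / z (S j))).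
  2:{ apply (ex_series_scal (K := R_AbsRing) (V := R_NormedModule)); exact Hsum. }
  intros j; unfold tail_term, bracket.
  set (n := (S N + 1 + j)%nat).
  rewrite Rprod1_S.
  (* Passing from z_n down to z_(j+1) aligns the bound with the indexing of the hypothesis on 1 /
     z. *)
  assert (Hzj : z (S j) <= z n) by (left; apply Hinc; unfold n; lia).
  assert (HzN : z (S (S N)) <= z n).
  { destruct j as [|j].
    - right; f_equal; unfold n; lia.
    - left; apply Hinc; unfold n; lia. }
  assert (Hzpos : 0 < z (S j)) by (pose proof (Hz (S j) ltac:(lia)); lra).
  assert (HNpos : 0 < z (S N)) by (pose proof (Hz (S N) ltac:(lia)); lra).
  assert (HNpos' : 0 < z (S (S N))) by (pose proof (Hz (S (S N)) ltac:(lia)); lra).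
  assert (Hprod : q <= Rprod1 (fun i => z n - z i) N).
  { apply Rprod1_le; intros i Hi.
    assert (z i < z (S N)) by (apply Hinc; lia).
    assert (z (S N) < z n) by (apply Hinc; unfold n; lia); lra. }
  assert (Hlast : (1 - th) * z (S j) <= z n - z (S N)).
  { assert (z (S N) <= th * z n).
    { apply Rle_trans with (th * z (S (S N))).
      - right; unfold th; field; lra.
      - apply Rmult_le_compat_l; [unfold th; apply Rdiv_le_0_compat; lra|lra]. }
    assert ((1 - th) * z (S j) <= (1 - th) * z n) by (apply Rmult_le_compat_l; lra).
    lra. }
  assert (Hden : 0 < Rpower (z 1%nat) alpha * (q * (1 - th)) * z (S j)).
  { repeat apply Rmult_lt_0_compat; try lra; apply Rpower_pos. }
  assert (Hle : Rpower (z 1%nat) alpha * (q * (1 - th)) * z (S j)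
                <= Rpower (z n) alpha
                   * (Rprod1 (fun i => z n - z i) N * (z n - z (S N)))).
  { rewrite !Rmult_assoc; apply Rmult_le_compat.
    - left; apply Rpower_pos.
    - repeat apply Rmult_le_pos; lra.
    - apply Rle_Rpower_l; [lra|split; [lra|apply Hz; unfold n; lia]].
    - apply Rmult_le_compat; try lra; apply Rmult_le_pos; lra. }
  change (Rabs (1 / (Rpower (z n) alpha * (Rprod1 (fun i => z n - z i) N * (z n - z (S N)))))
          <= / (Rpower (z 1%nat) alpha * (q * (1 - th))) * / z (S j)).
  unfold Rdiv at 1; rewrite Rmult_1_l, <- Rinv_mult, Rabs_pos_eq.
  - apply Rinv_le_contravar; assumption.
  - left; apply Rinv_0_lt_compat; lra.
Qed.

(** The error of the [N]-term Newton interpolation of [y |-> 1 / (y - x)] at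
    the nodes [z_1, ..., z_N], weighted by [y^(-alpha)] and evaluated at the
    node [y = z_(N+1+j)]. *)
Definition newton_remainder (z : nat -> R) (alpha : R) (x : C) (N j : nat) : C :=
  Cmult (kernel z alpha x (N + 1 + j))
    (Cdiv (Cprod1 (fun l => Cminus x (RtoC (z l))) N)
          (RtoC (Rprod1 (fun l => z (N + 1 + j)%nat - z l) N))).

(** Both remainders sit at the same node z_n, n = N + 2 + j. Their quotient is (x - z_(N+1)) / (z_n
    - z_(N+1)), and one minus it equals (z_n - x) / (z_n - z_(N+1)), whose numerator cancels the
    pole of [kernel]. *)
Lemma newton_remainder_step (z : nat -> R) (alpha : R) (x : C) (N j : nat) :
  Cmod x < z 1%nat ->
  (forall i j, (1 <= i < j)%nat -> z i < z j) ->
  Cminus (newton_remainder z alpha x N (S j)) (newton_remainder z alpha x (S N) j)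
  = Cmult (Cprod1 (fun l => Cminus x (RtoC (z l))) N) (RtoC (tail_term z alpha (S N) j)).
Proof.
  intros Hx Hinc; unfold newton_remainder, tail_term, bracket, kernel.
  replace (N + 1 + S j)%nat with (S N + 1 + j)%nat by lia.
  set (n := (S N + 1 + j)%nat).
  rewrite Cprod1_S, Rprod1_S.
  assert (Hgap : forall i, (1 <= i <= S N)%nat -> 0 < z n - z i).
  { intros i Hi; assert (z i < z n) by (apply Hinc; unfold n; lia); lra. }
  assert (Hw := Rpower_pos (z n) alpha).
  assert (HQ : 0 < Rprod1 (fun l => z n - z l) N).
  { apply Rprod1_pos; intros; apply Hgap; lia. }
  assert (Hlast := Hgap (S N) ltac:(lia)).
  assert (Hzn : z 1%nat <= z n) by (apply node_ge_first; [exact Hinc|unfold n; lia]).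
  assert (Hne := node_minus_neq_0 (z n) x ltac:(lra)).
  assert (HlastC := RtoC_neq_0 _ Hlast).
  rewrite RtoC_div by (repeat apply Rmult_integral_contrapositive_currified; lra).
  apply RtoC_neq_0 in Hw, HQ.
  rewrite !RtoC_mult, !RtoC_minus.
  rewrite RtoC_minus in HlastC.
  field; repeat split; assumption.
Qed.

(** The next step interpolates at z_(N+1), so the remainder at that node disappears entirely. This
    lost term is the source of the first summand of [gamma]. *)
Lemma newton_remainder_first (z : nat -> R) (alpha : R) (x : C) (N : nat) :
  Cmod x < z 1%nat ->
  (forall i j, (1 <= i < j)%nat -> z i < z j) ->
  newton_remainder z alpha x N 0
  = Cmult (Cprod1 (fun l => Cminus x (RtoC (z l))) N)
      (Cmult (Cdiv 1 (Cminus (RtoC (z (S N))) x))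
         (Cdiv 1 (RtoC (bracket z alpha (S N) N)))).
Proof.
  intros Hx Hinc; unfold newton_remainder, bracket, kernel.
  replace (N + 1 + 0)%nat with (S N) by lia.
  assert (Hw := Rpower_pos (z (S N)) alpha).
  assert (HQ : 0 < Rprod1 (fun l => z (S N) - z l) N).
  { apply Rprod1_pos; intros i Hi; assert (z i < z (S N)) by (apply Hinc; lia); lra. }
  assert (Hzn : z 1%nat <= z (S N)) by (apply node_ge_first; [exact Hinc|lia]).
  assert (Hne := node_minus_neq_0 (z (S N)) x ltac:(lra)).
  apply RtoC_neq_0 in Hw, HQ.
  rewrite RtoC_mult.
  field; repeat split; assumption.
Qed.

Lemma is_series_newton (z : nat -> R) (alpha : R) (x : C) (A : nat -> R) :
  0 <= alpha -> Cmod x < z 1%nat ->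
  (forall i j, (1 <= i < j)%nat -> z i < z j) ->
  ex_series (fun j => / z (S j)) ->
  (forall N n, (N < n)%nat ->
     Cmod (Cprod1 (fun l => Cminus x (RtoC (z l))) N)
     <= A N * Rprod1 (fun l => z n - z l) N) ->
  is_lim_seq A 0 ->
  is_series
    (fun N => Cmult (gamma z alpha (S N) x)
                (Cprod1 (fun l => Cminus x (RtoC (z l))) N))
    (CSeries (fun j => kernel z alpha x (S j))).
Proof.
  intros Ha Hx Hinc Hsum HA Hlim.
  assert (Hz1 : 0 < z 1%nat) by (pose proof (Cmod_ge_0 x); lra).
  assert (Hz : forall n, (1 <= n)%nat -> z 1%nat <= z n).
  { intros n Hn; now apply node_ge_first. }
  set (K := / (Rpower (z 1%nat) alpha * (1 - Cmod x / z 1%nat))).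
  assert (HK : 0 < K).
  { apply Rinv_0_lt_compat, Rmult_lt_0_compat; [apply Rpower_pos|].
    assert (Cmod x / z 1%nat < 1) by (apply Rlt_div_l; lra); lra. }
  (* For [N = 0] both products in the remainder are empty and only [kernel] is left. *)
  replace (CSeries (fun j => kernel z alpha x (S j)))
    with (CSeries (newton_remainder z alpha x 0)).
  2:{ unfold CSeries; f_equal; apply Series_ext; intros j; f_equal;
      unfold newton_remainder, Cprod1, Rprod1, Iter.iter_nat; simpl; field;
      intros E; apply RtoC_inj in E; lra. }
  apply (is_series_remainders (newton_remainder z alpha x) _ A (fun j => K * / z (S j))).
  - apply (ex_series_scal (K := R_AbsRing) (V := R_NormedModule)); exact Hsum.
  - intros N j; unfold newton_remainder.
    set (n := (N + 1 + j)%nat).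
    assert (HQ : 0 < Rprod1 (fun l => z n - z l) N).
    { apply Rprod1_pos; intros i Hi.
      assert (z i < z n) by (apply Hinc; unfold n; lia); lra. }
    (* Comparing with z_(j+1) instead of z_n keeps the second factor of the bound independent of
       [N]. *)
    assert (HzSj : z 1%nat <= z (S j)) by (apply Hz; lia).
    assert (HSj : z (S j) <= z n).
    { destruct N as [|N].
      - right; reflexivity.
      - left; apply Hinc; unfold n; lia. }
    rewrite Cmod_mult, Cmod_div by (now apply RtoC_neq_0).
    rewrite Cmod_R, (Rabs_pos_eq _ (Rlt_le _ _ HQ)), Rmult_comm.
    apply Rmult_le_compat.
    + apply Rdiv_le_0_compat; [apply Cmod_ge_0|exact HQ].
    + apply Cmod_ge_0.
    + apply Rle_div_l; [exact HQ|apply HA; unfold n; lia].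
    + eapply Rle_trans; [apply Cmod_kernel_le; try assumption; apply Hz; unfold n; lia|].
      apply Rmult_le_compat_l; [left; exact HK|].
      apply Rinv_le_contravar; lra.
  - exact Hlim.
  - intros N H0 H1.
    set (P := Cprod1 (fun l => Cminus x (RtoC (z l))) N).
    assert (Htail : is_series (fun j => RtoC (tail_term z alpha (S N) j))
                      (RtoC (Series (tail_term z alpha (S N))))).
    { apply is_series_RtoC.
      - intros j; unfold tail_term, bracket; left.
        apply Rdiv_lt_0_compat; [lra|].
        apply Rmult_lt_0_compat; [apply Rpower_pos|].
        apply Rprod1_pos; intros i Hi.
        assert (z i < z (S N + 1 + j)%nat) by (apply Hinc; lia); lra.
      - apply ex_series_tail_term; try assumption; lia. }
    apply (is_series_scal P) in Htail.
    set (S0 := CSeries (newton_remainder z alpha x N)) in *.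
    set (S1 := CSeries (newton_remainder z alpha x (S N))) in *.
    (* Index [S j] after [N] terms and index [j] after [N + 1] terms denote the same node. The first
       series therefore loses its initial term before the two are subtracted; the tail terms give
       the rest of [gamma]. *)
    assert (Hshift : is_series (fun j => newton_remainder z alpha x N (S j))
                       (Cminus S0 (newton_remainder z alpha x N 0))).
    { apply (@is_series_incr_1 C_AbsRing C_NormedModule).
      refine (eq_ind S0 (is_series (newton_remainder z alpha x N)) H0 _ _).
      change (S0 = Cplus (Cminus S0 (newton_remainder z alpha x N 0))
                         (newton_remainder z alpha x N 0)); ring. }
    pose proof (is_series_minus _ _ _ _ Hshift H1) as Hdiff.
    apply CSeries_unique in Htail, Hdiff.
    assert (E : Cmult P (RtoC (Series (tail_term z alpha (S N))))
                = Cminus (Cminus S0 (newton_remainder z alpha x N 0)) S1).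
    { transitivity (CSeries (fun j => Cmult P (RtoC (tail_term z alpha (S N) j))));
        [symmetry; exact Htail|].
      etransitivity; [|exact Hdiff].
      unfold CSeries; f_equal; apply Series_ext; intros j; f_equal; symmetry;
        apply newton_remainder_step; assumption. }
    unfold gamma; replace (S N - 1)%nat with N by lia.
    rewrite newton_remainder_first in E by assumption; fold P in E.
    replace (Cminus S0 S1) with
      (Cplus (Cminus (Cminus S0 (Cmult P (Cmult (Cdiv 1 (Cminus (RtoC (z (S N))) x))
         (Cdiv 1 (RtoC (bracket z alpha (S N) N)))))) S1)
         (Cmult P (Cmult (Cdiv 1 (Cminus (RtoC (z (S N))) x))
         (Cdiv 1 (RtoC (bracket z alpha (S N) N)))))) by ring.
    rewrite <- E; ring.
Qed.

(** * Power series of zeta values as a geometric expansion *)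

Lemma zeta_term_RtoC (z : nat -> R) (r : R) (n : nat) :
  zeta_term z (RtoC r) n = RtoC (Rpower (z n) (- r)).
Proof.
  unfold zeta_term, Rcpow, Rpower, Re, Im; simpl.
  rewrite Ropp_0, Rmult_0_l, cos_0, sin_0.
  change (1, 0) with (RtoC 1); apply Cmult_1_r.
Qed.

Lemma zeta_RtoC (z : nat -> R) (r : R) :
  zeta z (RtoC r) = RtoC (Series (fun j => Rpower (z (S j)) (- r))).
Proof.
  rewrite <- CSeries_RtoC; unfold zeta, CSeries.
  f_equal; apply Series_ext; intros j; now rewrite zeta_term_RtoC.
Qed.

(** Write z_n^(-r) = z_n^(-(r-1)) / z_n and bound the first factor by its value at z_1, using r >=
    1. *)
Lemma ex_series_Rpower_neg (z : nat -> R) (r : R) :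
  1 <= r -> 0 < z 1%nat ->
  (forall i j, (1 <= i < j)%nat -> z i < z j) ->
  ex_series (fun j => / z (S j)) ->
  ex_series (fun j => Rpower (z (S j)) (- r)).
Proof.
  intros Hr Hz1 Hinc Hsum.
  apply (ex_series_le (K := R_AbsRing) (V := R_CompleteNormedModule) _
           (fun j => / Rpower (z 1%nat) (r - 1) * / z (S j))).
  2:{ apply (ex_series_scal (K := R_AbsRing) (V := R_NormedModule)); exact Hsum. }
  intros j.
  assert (Hj : z 1%nat <= z (S j)) by (apply node_ge_first; [exact Hinc|lia]).
  change (Rabs (Rpower (z (S j)) (- r)) <= / Rpower (z 1%nat) (r - 1) * / z (S j)).
  rewrite Rabs_pos_eq by (left; apply Rpower_pos).
  replace (- r) with (- (r - 1) + - (1)) by ring.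
  rewrite Rpower_plus, !Rpower_Ropp, Rpower_1 by lra.
  apply Rmult_le_compat_r; [left; apply Rinv_0_lt_compat; lra|].
  apply Rinv_le_contravar; [apply Rpower_pos|].
  apply Rle_Rpower_l; lra.
Qed.

(** The remainder of the geometric series for [kernel] after [m] terms is [kernel] times (x /
    z_n)^m, at most (|x| / z_1)^m times a summable bound. Consecutive remainders differ by x^m
    z_n^(-(m+alpha+1)), which sums over [n] to the zeta term. *)
Lemma is_series_zeta (z : nat -> R) (alpha : R) (x : C) :
  0 <= alpha -> Cmod x < z 1%nat ->
  (forall i j, (1 <= i < j)%nat -> z i < z j) ->
  ex_series (fun j => / z (S j)) ->
  is_series
    (fun m => Cmult (zeta z (RtoC (INR m + alpha + 1))) (Cpow x m))
    (CSeries (fun j => kernel z alpha x (S j))).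
Proof.
  intros Ha Hx Hinc Hsum.
  pose proof (Cmod_ge_0 x) as Hx0.
  assert (Hz1 : 0 < z 1%nat) by lra.
  assert (Hz : forall n, (1 <= n)%nat -> z 1%nat <= z n).
  { intros n Hn; now apply node_ge_first. }
  set (q := Cmod x / z 1%nat).
  assert (Hq : 0 <= q < 1).
  { split; [apply Rdiv_le_0_compat; lra|apply Rlt_div_l; lra]. }
  set (K := / (Rpower (z 1%nat) alpha * (1 - q))).
  set (r := fun m j => Cmult (kernel z alpha x (S j)) (Cpow (Cdiv x (RtoC (z (S j)))) m)).
  replace (CSeries (fun j => kernel z alpha x (S j))) with (CSeries (r 0%nat)).
  2:{ unfold CSeries; f_equal; apply Series_ext; intros j; f_equal; apply Cmult_1_r. }
  apply (is_series_remainders r _ (fun m => q ^ m) (fun j => K * / z (S j))).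
  - apply (ex_series_scal (K := R_AbsRing) (V := R_NormedModule)); exact Hsum.
  - intros m j; unfold r.
    assert (Hj : z 1%nat <= z (S j)) by (apply Hz; lia).
    rewrite Cmod_mult, Cmod_pow, Rmult_comm.
    apply Rmult_le_compat.
    + apply pow_le, Cmod_ge_0.
    + apply Cmod_ge_0.
    + apply pow_incr; split; [apply Cmod_ge_0|].
      rewrite Cmod_div by (apply RtoC_neq_0; lra).
      rewrite Cmod_R, Rabs_pos_eq by lra.
      apply Rmult_le_compat_l; [exact Hx0|apply Rinv_le_contravar; lra].
    + apply Cmod_kernel_le; assumption.
  - apply is_lim_seq_geom; rewrite Rabs_pos_eq; apply Hq.
  - intros m H0 H1.
    rewrite zeta_RtoC.
    set (rho := INR m + alpha + 1).
    assert (Hpow : is_series (fun j => RtoC (Rpower (z (S j)) (- rho)))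
                     (RtoC (Series (fun j => Rpower (z (S j)) (- rho))))).
    { apply is_series_RtoC; [intros; left; apply Rpower_pos|].
      apply ex_series_Rpower_neg; try assumption.
      unfold rho; pose proof (pos_INR m); lra. }
    apply (is_series_scal (Cpow x m)), CSeries_unique in Hpow.
    pose proof (is_series_minus _ _ _ _ H0 H1) as Hdiff; apply CSeries_unique in Hdiff.
    rewrite Cmult_comm; etransitivity; [symmetry; exact Hpow|].
    etransitivity; [|exact Hdiff].
    (* The factor 1 - x / z_n = (z_n - x) / z_n cancels the denominator of [kernel]. *)
    assert (Hterm : forall j, Cmult (Cpow x m) (RtoC (Rpower (z (S j)) (- rho)))
                              = Cminus (r m j) (r (S m) j)).
    { intros j; unfold r, kernel, rho.
      assert (Hj : z 1%nat <= z (S j)) by (apply Hz; lia).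
      rewrite Rpower_Ropp, !Rpower_plus, Rpower_pow, Rpower_1 by lra.
      assert (Hw := RtoC_neq_0 _ (Rpower_pos (z (S j)) alpha)).
      assert (Hzc := RtoC_neq_0 (z (S j)) ltac:(lra)).
      assert (Hne := node_minus_neq_0 (z (S j)) x ltac:(lra)).
      assert (Hzm := Cpow_nz _ m Hzc).
      assert (Hzmr : z (S j) ^ m <> 0) by (apply pow_nonzero; lra).
      assert (Hwr := Rpower_pos (z (S j)) alpha).
      rewrite RtoC_inv, !RtoC_mult, RtoC_pow
        by (repeat apply Rmult_integral_contrapositive_currified; lra).
      rewrite Cpow_S; unfold Cdiv; rewrite Cpow_mult_l, Cpow_inv by exact Hzc.
      field; repeat split; assumption. }
    unfold CSeries; f_equal; apply Series_ext; intros j; f_equal; apply Hterm.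
Qed.

(** * Real powers: Bernoulli, gaps, summability and the ratio product *)

Lemma ln_le_minus_1 (t : R) : 0 < t -> ln t <= t - 1.
Proof.
  intros Ht; pose proof (exp_ineq1_le (ln t)) as H; rewrite exp_ln in H by exact Ht; lra.
Qed.

(** When the left side [a] is positive, ln a - b ln t = ln (a / t) + (b - 1) ln (1 / t). Applying ln
    y <= y - 1 to both logarithms gives upper bounds that add up to exactly 0. *)
Lemma Rpower_Bernoulli (t b : R) : 0 < t -> 1 <= b -> 1 + b * (t - 1) <= Rpower t b.
Proof.
  intros Ht Hb; set (a := 1 + b * (t - 1)).
  destruct (Rle_or_lt a 0) as [Ha|Ha].
  { pose proof (Rpower_pos t b); lra. }
  unfold Rpower; rewrite <- (exp_ln a) at 1 by exact Ha.
  assert (H1 : ln (a / t) <= a / t - 1) by (apply ln_le_minus_1, Rdiv_lt_0_compat; assumption).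
  assert (H2 : ln (/ t) <= / t - 1) by (apply ln_le_minus_1, Rinv_0_lt_compat; assumption).
  unfold Rdiv in H1; rewrite ln_mult in H1 by (try apply Rinv_0_lt_compat; assumption).
  rewrite ln_Rinv in H1, H2 by exact Ht.
  assert (H3 : (b - 1) * - ln t <= (b - 1) * (/ t - 1)) by (apply Rmult_le_compat_l; lra).
  assert (H4 : a * / t - 1 + (b - 1) * (/ t - 1) = 0) by (unfold a; field; lra).
  assert (H : ln a <= b * ln t) by lra.
  destruct H as [H|H]; [left; now apply exp_increasing|right; now rewrite H].
Qed.

(** Tangent-line inequality at [u] for the convex function t^b: Bernoulli at t = v / u, multiplied
    by u^b. *)
Lemma Rpower_gap (u v b : R) : 0 < u -> 0 < v -> 1 <= b ->
  b * Rpower u (b - 1) * (v - u) <= Rpower v b - Rpower u b.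
Proof.
  intros Hu Hv Hb.
  assert (Hq : 0 < v / u) by (apply Rdiv_lt_0_compat; assumption).
  pose proof (Rpower_Bernoulli (v / u) b Hq Hb) as HB.
  assert (Ev : Rpower v b = Rpower u b * Rpower (v / u) b).
  { rewrite Rpower_mult_distr by assumption; f_equal; field; lra. }
  assert (Eu : Rpower u b = Rpower u (b - 1) * u).
  { rewrite <- (Rpower_1 u) at 3 by exact Hu; rewrite <- Rpower_plus; f_equal; ring. }
  rewrite Ev.
  apply Rle_trans with (Rpower u b * (1 + b * (v / u - 1)) - Rpower u b).
  - right; rewrite Eu; field; lra.
  - assert (Rpower u b * (1 + b * (v / u - 1)) <= Rpower u b * Rpower (v / u) b).
    { apply Rmult_le_compat_l; [left; apply Rpower_pos|exact HB]. }
    lra.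
Qed.

Lemma is_lim_seq_ln_shift (c : R) : is_lim_seq (fun j => ln (INR (S j) + c)) p_infty.
Proof.
  apply (is_lim_comp_seq ln (fun j => INR (S j) + c) p_infty p_infty).
  - apply is_lim_ln_p.
  - exists 0%nat; intros; discriminate.
  - apply is_lim_seq_plus with p_infty c; [|apply is_lim_seq_const|reflexivity].
    apply (is_lim_seq_incr_1 INR), is_lim_seq_INR.
Qed.

Lemma is_lim_seq_Rpower_neg (c p : R) : 0 < p ->
  is_lim_seq (fun j => Rpower (INR (S j) + c) (- p)) 0.
Proof.
  intros Hp; unfold Rpower.
  apply (is_lim_comp_seq exp (fun j => - p * ln (INR (S j) + c)) m_infty 0).
  - apply is_lim_exp_m.
  - exists 0%nat; intros; discriminate.
  - pose proof (is_lim_seq_scal_l _ (- p) _ (is_lim_seq_ln_shift c)) as H.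
    simpl in H; destruct (Rle_dec 0 (- p)); [lra|exact H].
Qed.

(* With u = v - 1, Bernoulli-type estimates give (b - 1) v^(-b) <= u^(1-b) - v^(1-b),
   whose right-hand side telescopes. *)
Lemma ex_series_Rpower_shift (c b : R) : -1 < c -> 1 < b ->
  ex_series (fun j => / Rpower (INR (S j) + c) b).
Proof.
  intros Hc Hb; set (p := b - 1); assert (Hp : 0 < p) by (unfold p; lra).
  (* Without its first term the series runs over v = j + 2 + c, so u = v - 1 = j + 1 + c stays
     positive. *)
  apply (ex_series_incr_1 (fun j => / Rpower (INR (S j) + c) b)).
  set (T := fun j => Rpower (INR (S j) + c) (- p)).
  assert (Hu : forall j, 0 < INR (S j) + c).
  { intros j; rewrite S_INR; pose proof (pos_INR j); lra. }
  apply (ex_series_le (K := R_AbsRing) (V := R_CompleteNormedModule) _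
           (fun j => / p * (T j - T (S j)))).
  - intros j.
    set (u := INR (S j) + c); set (v := INR (S (S j)) + c).
    assert (Euv : v = u + 1) by (unfold u, v; rewrite (S_INR (S j)); ring).
    assert (Hu0 : 0 < u) by apply Hu.
    change (Rabs (/ Rpower v b) <= / p * (Rpower u (- p) - Rpower v (- p))).
    rewrite Rabs_pos_eq by (left; apply Rinv_0_lt_compat, Rpower_pos).
    apply Rmult_le_reg_l with p; [exact Hp|].
    replace (p * (/ p * (Rpower u (- p) - Rpower v (- p))))
      with (Rpower u (- p) - Rpower v (- p)) by (field; lra).
    assert (Eu : Rpower u (- p) = Rpower v (- p) * Rpower (u / v) (- p)).
    { rewrite Rpower_mult_distr;
        [f_equal; field; lra | lra | apply Rdiv_lt_0_compat; lra]. }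
    assert (Ev : / Rpower v b = Rpower v (- p) * / v).
    { rewrite <- Rpower_Ropp; replace (- b) with (- p + - (1)) by (unfold p; ring).
      rewrite Rpower_plus, (Rpower_Ropp v 1), Rpower_1 by lra; reflexivity. }
    (* Combines exp y >= 1 + y at y = -p ln (u / v) with -ln (u / v) >= 1 - u / v = 1 / v. *)
    assert (Hq : 1 + p * / v <= Rpower (u / v) (- p)).
    { unfold Rpower.
      pose proof (exp_ineq1_le (- p * ln (u / v))) as H1.
      pose proof (ln_le_minus_1 (u / v) ltac:(apply Rdiv_lt_0_compat; lra)) as H2.
      assert (E : u / v - 1 = - / v) by (rewrite Euv; field; lra).
      rewrite E in H2.
      assert (p * / v <= p * - ln (u / v)) by (apply Rmult_le_compat_l; lra).
      lra. }
    rewrite Ev, Eu.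
    assert (Rpower v (- p) * (1 + p * / v) <= Rpower v (- p) * Rpower (u / v) (- p)).
    { apply Rmult_le_compat_l; [left; apply Rpower_pos|exact Hq]. }
    lra.
  - apply (ex_series_scal (K := R_AbsRing) (V := R_NormedModule)).
    exists (T 0%nat).
    change (is_lim_seq (sum_n (fun j => T j - T (S j))) (T 0%nat)).
    apply (is_lim_seq_ext (fun n => T 0%nat - T (S n))).
    + induction n as [|n IH]; [now rewrite sum_O|].
      rewrite sum_Sn, <- IH; unfold plus; simpl; ring.
    + replace (Finite (T 0%nat)) with (Finite (T 0%nat - 0)) by (f_equal; ring).
      apply is_lim_seq_minus'; [apply is_lim_seq_const|].
      apply (is_lim_seq_incr_1 T), is_lim_seq_Rpower_neg; exact Hp.
Qed.

(** The quotient of consecutive products is the newest factor, which tends to 1 / b < 1. By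
    d'Alembert's test the products are even summable, hence tend to 0. *)
Lemma is_lim_seq_Rprod1_ratio (c b e : R) : -1 < c -> 1 < b -> 0 <= e ->
  is_lim_seq
    (Rprod1 (fun l => (Rpower (INR l + c) b + e)
                      / (b * Rpower (INR l + c) (b - 1) * INR l))) 0.
Proof.
  intros Hc Hb He.
  set (f := fun l => (Rpower (INR l + c) b + e)
                     / (b * Rpower (INR l + c) (b - 1) * INR l)).
  assert (Hf : forall l, (1 <= l)%nat -> 0 < f l).
  { intros l Hl; apply lt_0_INR in Hl.
    pose proof (Rpower_pos (INR l + c) b); pose proof (Rpower_pos (INR l + c) (b - 1)).
    apply Rdiv_lt_0_compat; [lra|].
    repeat apply Rmult_lt_0_compat; lra. }
  assert (Hprod : forall n, 0 < Rprod1 f n).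
  { intros n; apply Rprod1_pos; intros i Hi; apply Hf; lia. }
  apply (is_lim_seq_ext (fun n => Rabs (Rprod1 f n))).
  { intros n; apply Rabs_pos_eq; left; apply Hprod. }
  apply ex_series_lim_0.
  apply ex_series_DAlembert with (/ b).
  - rewrite <- Rinv_1; apply Rinv_lt_contravar; lra.
  - intros n; pose proof (Hprod n); lra.
  (* With l = n + 1 and u = l + c, the factor (u^b + e) / (b u^(b-1) l) splits as (1 + e u^(-b)) (u
     / l) / b, and u / l = 1 + c / l. *)
  - apply (is_lim_seq_ext (fun n => (1 + e * / Rpower (INR (S n) + c) b)
                                    * (1 + c * / INR (S n)) * / b)).
    + intros n; rewrite Rprod1_S.
      pose proof (Hprod n); pose proof (Hf (S n) ltac:(lia)).
      replace (Rprod1 f n * f (S n) / Rprod1 f n) with (f (S n)) by (field; lra).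
      rewrite Rabs_pos_eq by lra; unfold f.
      assert (Hn : 0 < INR (S n)) by (apply lt_0_INR; lia).
      assert (Hu : 0 < INR (S n) + c) by (rewrite S_INR; pose proof (pos_INR n); lra).
      set (u := INR (S n) + c) in *.
      assert (Eu : Rpower u b = Rpower u (b - 1) * u).
      { rewrite <- (Rpower_1 u) at 3 by exact Hu; rewrite <- Rpower_plus; f_equal; ring. }
      pose proof (Rpower_pos u (b - 1)).
      rewrite Eu; unfold u; field; fold u; lra.
    + replace (Finite (/ b)) with (Finite ((1 + e * 0) * (1 + c * 0) * / b))
        by (f_equal; ring).
      apply is_lim_seq_mult'; [apply is_lim_seq_mult'|apply is_lim_seq_const].
      * apply is_lim_seq_plus'; [apply is_lim_seq_const|].
        apply is_lim_seq_mult'; [apply is_lim_seq_const|].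
        apply (is_lim_seq_ext (fun j => Rpower (INR (S j) + c) (- b))).
        -- intros; apply Rpower_Ropp.
        -- apply is_lim_seq_Rpower_neg; lra.
      * apply is_lim_seq_plus'; [apply is_lim_seq_const|].
        apply is_lim_seq_mult'; [apply is_lim_seq_const|].
        apply (is_lim_seq_inv (fun j => INR (S j)) p_infty); [|discriminate].
        apply (is_lim_seq_incr_1 INR), is_lim_seq_INR.
Qed.

(** * The nodes (n + c)^beta + d *)

Lemma zseq_lt (c d beta : R) (i j : nat) :
  -1 < c -> 0 < beta -> (1 <= i < j)%nat -> zseq c d beta i < zseq c d beta j.
Proof.
  intros Hc Hb Hij; unfold zseq; apply Rplus_lt_compat_r.
  assert (INR 1 <= INR i) by (apply le_INR; lia); change (INR 1) with 1 in *.
  assert (INR i < INR j) by (apply lt_INR; lia).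
  apply Rlt_Rpower_l; lra.
Qed.

Lemma zseq_gap (c d beta : R) (l n : nat) :
  -1 < c -> 1 < beta -> (1 <= l)%nat -> (1 <= n)%nat ->
  beta * Rpower (INR l + c) (beta - 1) * (INR n - INR l)
  <= zseq c d beta n - zseq c d beta l.
Proof.
  intros Hc Hb Hl Hn; unfold zseq.
  apply le_INR in Hl, Hn; change (INR 1) with 1 in *.
  pose proof (Rpower_gap (INR l + c) (INR n + c) beta
                ltac:(lra) ltac:(lra) ltac:(lra)) as H.
  replace (INR n + c - (INR l + c)) with (INR n - INR l) in H by ring; lra.
Qed.

(** The bound l <= n - l can fail for single factors, so the linear parts are compared only as whole
    products, N! against that of the n - l. The weights [g l] come from the gap estimate and make
    the first product independent of [n]. *)
Lemma Cmod_zseq_prod_le (c d beta : R) (x : C) (N n : nat) :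
  -1 < c -> 0 <= d -> 1 < beta -> (N < n)%nat ->
  Cmod (Cprod1 (fun l => Cminus x (RtoC (zseq c d beta l))) N)
  <= Rprod1 (fun l => (Rpower (INR l + c) beta + (d + Cmod x))
                      / (beta * Rpower (INR l + c) (beta - 1) * INR l)) N
     * Rprod1 (fun l => zseq c d beta n - zseq c d beta l) N.
Proof.
  intros Hc Hd Hb Hn.
  pose proof (Cmod_ge_0 x) as Hx.
  set (g := fun l => beta * Rpower (INR l + c) (beta - 1)).
  set (f := fun l => (Rpower (INR l + c) beta + (d + Cmod x)) / (g l * INR l)).
  assert (Hg : forall l, 0 < g l).
  { intros l; apply Rmult_lt_0_compat; [lra|apply Rpower_pos]. }
  assert (Hf : forall l, (1 <= l)%nat -> 0 < f l).
  { intros l Hl; apply lt_0_INR in Hl; pose proof (Rpower_pos (INR l + c) beta).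
    apply Rdiv_lt_0_compat; [lra|apply Rmult_lt_0_compat; auto]. }
  apply Rle_trans with (Rprod1 (fun l => f l * (g l * INR l)) N).
  - apply Cmod_Cprod1_le; intros l Hl.
    assert (0 < INR l) by (apply lt_0_INR; lia).
    pose proof (Hg l); pose proof (Rpower_pos (INR l + c) beta).
    replace (f l * (g l * INR l)) with (Rpower (INR l + c) beta + (d + Cmod x))
      by (unfold f; field; lra).
    eapply Rle_trans; [apply Cmod_triangle|].
    rewrite Cmod_opp, Cmod_R; unfold zseq; rewrite Rabs_pos_eq; lra.
  - rewrite Rprod1_mult; apply Rmult_le_compat_l.
    { left; apply Rprod1_pos; intros l Hl; apply Hf; lia. }
    apply Rle_trans with (Rprod1 (fun l => g l * (INR n - INR l)) N).
    + rewrite !Rprod1_mult; apply Rmult_le_compat_l.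
      * left; apply Rprod1_pos; intros; apply Hg.
      * apply Rprod1_INR_le; exact Hn.
    + apply Rprod1_le; intros l Hl; split.
      * assert (INR l < INR n) by (apply lt_INR; lia).
        apply Rmult_lt_0_compat; [apply Hg|lra].
      * apply zseq_gap; [exact Hc|exact Hb|lia|lia].
Qed.

Lemma ex_series_inv_zseq (c d beta : R) :
  -1 < c -> 0 <= d -> 1 < beta -> ex_series (fun j => / zseq c d beta (S j)).
Proof.
  intros Hc Hd Hb.
  apply (ex_series_le (K := R_AbsRing) (V := R_CompleteNormedModule) _
           (fun j => / Rpower (INR (S j) + c) beta)).
  2: now apply ex_series_Rpower_shift.
  intros j; pose proof (Rpower_pos (INR (S j) + c) beta).
  change (Rabs (/ zseq c d beta (S j)) <= / Rpower (INR (S j) + c) beta).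
  unfold zseq; rewrite Rabs_pos_eq by (left; apply Rinv_0_lt_compat; lra).
  apply Rinv_le_contravar; lra.
Qed.

(** * Both expansions at these nodes *)

Theorem theorem2p3 :
  forall (c d beta alpha : R),
    -1 < c -> 0 <= d -> 1 < beta -> 0 <= alpha ->
    let z := zseq c d beta in
    forall x : C,
      Cmod x < Rmin 1 (z 1%nat) ->
      (* the series defining the zeta values and the gamma_k converge *)
      (forall m : nat,
          ex_series (fun j => zeta_term z (RtoC (INR m + alpha + 1)) (S j))) /\
      (forall k : nat, (1 <= k)%nat -> ex_series (tail_term z alpha k)) /\
      (* both sides converge, to the same sum *)
      exists s : C,
        is_series
          (fun m : nat => Cmult (zeta z (RtoC (INR m + alpha + 1))) (Cpow x m)) s /\
        is_series
          (fun j : nat =>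
             let k := S j in
             Cmult (gamma z alpha k x)
                   (Cprod1 (fun l => Cminus x (RtoC (z l))) (k - 1))) s.
Proof.
  intros c d beta alpha Hc Hd Hb Ha z x Hx.
  assert (Hx1 : Cmod x < z 1%nat) by (eapply Rlt_le_trans; [exact Hx|apply Rmin_r]).
  assert (Hz1 : 0 < z 1%nat) by (pose proof (Cmod_ge_0 x); lra).
  assert (Hinc : forall i j, (1 <= i < j)%nat -> z i < z j).
  { intros i j; apply zseq_lt; lra. }
  assert (Hsum : ex_series (fun j => / z (S j))) by now apply ex_series_inv_zseq.
  split; [|split].
  - intros m.
    eexists; eapply is_series_ext; [intros j; symmetry; apply zeta_term_RtoC|].
    apply is_series_RtoC; [intros; left; apply Rpower_pos|].
    apply ex_series_Rpower_neg; try assumption.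
    pose proof (pos_INR m); lra.
  - intros k Hk; now apply ex_series_tail_term.
  - exists (CSeries (fun j => kernel z alpha x (S j))); split.
    + now apply is_series_zeta.
    + apply (is_series_ext
        (fun N => Cmult (gamma z alpha (S N) x)
                    (Cprod1 (fun l => Cminus x (RtoC (z l))) N))).
      { intros N; cbv zeta; now replace (S N - 1)%nat with N by lia. }
      (* The bounding sequence stays open here; the product estimate fixes it as the ratio product
         with e = d + |x|, whose limit is then required. *)
      eapply is_series_newton; try assumption.
      * intros N n HNn; apply Cmod_zseq_prod_le; assumption.
      * apply is_lim_seq_Rprod1_ratio; [assumption|assumption|].
        pose proof (Cmod_ge_0 x); lra.
Qed.
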